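(* Let $P\subset\mathbb{R}^d$ be a centrally symmetric convex polytope with nonempty interior. Then there is a constant $\lambda$ with $A(P,z)=\lambda$ for every nonzero $z\in\mathbb{R}^d$ if and only if $P$ is a zonotope with generator set $V$ such that, for every $v\in V$, the number of edges of $P$ parallel to $v$ equals $\lambda$.
   Context: For a convex polytope $P\subset\mathbb{R}^d$ with nonempty interior and a nonzero vector $z\in\mathbb{R}^d$, put $t^-=\min\{zx:x\in P\}$ and $t^+=\max\{zx:x\in P\}$, where $zx$ denotes the scalar product. For $t\in[t^-,t^+]$ let $P(z,t)=P\cap\{x\in\mathbb{R}^d: zx=t\}$, a convex polytope. Define $$A(P,z)=\frac{1}{t^+-t^-}\int_{t^-}^{t^+}\#\{\text{vertices of }P(z,t)\}\,dt.$$ A zonotope is a Minkowski sum $[0,a_1]+\dots+[0,a_n]$ of segments, where $a_1,\dots,a_n\in\mathbb{R}^d$ are pairwise non-collinear vectors and $n\ge d$; the set $V=\{a_1,\dots,a_n\}$ is its generator set. Edges of $P$ are its one-dimensional faces.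
   Formalization: Zonotopes are taken up to translation: P is a translate of [0,a_1]+...+[0,a_n]. Read literally the claim fails for the square [-1,1]^2, where A(P,z)=2 for all z, though P is no sum of segments [0,a_i]. *)

(* Defs.v *)
(* R^d is represented by row vectors over an abstract realType R. *)
From HB Require Import structures.
From mathcomp Require Import all_boot all_order all_algebra.
From mathcomp Require Import finmap.
From mathcomp Require Import all_classical all_reals all_analysis.

Set Implicit Arguments.
Unset Strict Implicit.
Unset Printing Implicit Defensive.

Import Order.TTheory GRing.Theory Num.Theory.
Import numFieldNormedType.Exports.

Local Open Scope classical_set_scope.
Local Open Scope ring_scope.

(* Junk value 0 when A is infinite. *)
Definition ncard (T : choiceType) (A : set T) : nat := #|` fset_set A |.

Section Polytopes.
Variables (R : realType) (d : nat).
Local Notation V := 'rV[R]_d.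
Implicit Types (P F : set V) (x y z v : V) (t : R).

Definition dotp x y : R := \sum_(i < d) x 0 i * y 0 i.

Definition conv_hull m (p : 'I_m -> V) : set V :=
  [set \sum_(i < m) w i *: p i | w in
    [set w : 'I_m -> R | (forall i, 0 <= w i) /\ \sum_(i < m) w i = 1]].

Definition convex_polytope P : Prop :=
  exists m (p : 'I_m -> V), P = conv_hull p.

(* Central symmetry about an arbitrary centre c. *)
Definition centrally_symmetric P : Prop :=
  exists c : V, forall x, P x -> P (c *+ 2 - x).

(* Taking u = 0 shows that P (b = 0) and set0 (b = 1) count as faces. *)
Definition face P F : Prop :=
  exists (u : V) (b : R),
    (forall x, P x -> dotp u x <= b) /\ F = P `&` [set x | dotp u x = b].

(* U is the direction space of the affine hull of F, that is, the least
   subspace containing all differences of points of F. *)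
Definition direction F (U : {vspace V}) : Prop :=
  forall W : {vspace V},
    (U <= W)%VS <-> (forall x y, F x -> F y -> y - x \in W).

Definition has_dim F (k : nat) : Prop :=
  exists U : {vspace V}, direction F U /\ \dim U = k.

Definition vertices P : set V := [set x | face P [set x]].

Definition edges P : set (set V) := [set F | face P F /\ has_dim F 1].

Definition parallel F v : Prop :=
  forall x y, F x -> F y -> y - x \in <[v]>%VS.

Definition edges_parallel P v : set (set V) :=
  edges P `&` [set F | parallel F v].

Definition section P z t : set V := P `&` [set x | dotp z x = t].

Definition tmin P z : R := inf [set dotp z x | x in P].
Definition tmax P z : R := sup [set dotp z x | x in P].

Definition avg_vertices P z : R :=
  (tmax P z - tmin P z)^-1 *
  \int[@lebesgue_measure R]_(t in `[tmin P z, tmax P z])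
    (ncard (vertices (section P z t)))%:R.

Definition segment x y : set V :=
  [set (1 - s) *: x + s *: y | s in `[0, 1]].

Definition minkowski_sum n (A : 'I_n -> set V) : set V :=
  [set \sum_(i < n) x i | x in [set x : 'I_n -> V | forall i, A i (x i)]].

(* Both vectors lie on a common line through the origin. *)
Definition collinear x y : Prop :=
  exists w : V, x \in <[w]>%VS /\ y \in <[w]>%VS.

(* Zonotopes are taken up to translation: a centrally symmetric polytope may
   have any centre, whereas the sum of the segments [0, a_i] is centred at
   half the sum of the a_i. *)
Definition zonotope P n (a : 'I_n -> V) : Prop :=
  [/\ (d <= n)%N,
      forall i j, i != j -> ~ collinear (a i) (a j)
    & exists c : V, P = [set c + x | x in
        minkowski_sum (fun i => segment 0 (a i))]].

End Polytopes.

(* Main.v *)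
Require Import Defs.
From HB Require Import structures.
From mathcomp Require Import all_boot all_order all_algebra.
From mathcomp Require Import finmap.
From mathcomp Require Import all_classical all_reals all_analysis.
From mathcomp Require Import ring lra.

Set Implicit Arguments.
Unset Strict Implicit.
Unset Printing Implicit Defensive.

Import Order.TTheory GRing.Theory Num.Theory.
Import numFieldNormedType.Exports.

Local Open Scope classical_set_scope.
Local Open Scope ring_scope.

(* If t is not the height of a vertex of P, the vertices of P(z,t) are the
   points where the hyperplane zx = t crosses an edge of P. Integrating over t,
   A(P,z) times the width of P in direction z is the sum of |ze| over the edge
   vectors e of P. So A(P,.) = lambda says that lambda P has the same width
   function as the zonotope spanned by the edge vectors. Centrally symmetric
   convex bodies with the same width function are translates of each other, so
   P is the zonotope whose generators are the sums of parallel edge vectors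
   (suitably oriented) divided by lambda. Every edge of a zonotope is a
   translate of a generator, and comparing the lengths in the direction of a
   generator a gives N |a| = lambda |a| for the number N of edges parallel to a.
   The converse is the same computation read backwards. *)

Lemma continuous_sumr (K : numFieldType) (W : normedModType K)
    (T : topologicalType) (I : Type) (r : seq I) (f : I -> T -> W) :
  (forall i, continuous (f i)) -> continuous (fun t => \sum_(i <- r) f i t).
Proof.
move=> cf t; elim: r => [|i r IH].
  under eq_fun do rewrite big_nil.
  exact: cvg_cst.
under eq_fun do rewrite big_cons.
by apply: cvgD => //; exact: cf.
Qed.

(** * The scalar product *)

Section Dotp.
Variables (R : realType) (d : nat).
Local Notation V := 'rV[R]_d.
Implicit Types (x y z u v : V).

Lemma dotpC x y : dotp x y = dotp y x.
Proof. by apply: eq_bigr => i _; rewrite mulrC. Qed.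

Lemma dotpDr u x y : dotp u (x + y) = dotp u x + dotp u y.
Proof. by rewrite -big_split; apply: eq_bigr => i _; rewrite mxE mulrDr. Qed.

Lemma dotpZr u k x : dotp u (k *: x) = k * dotp u x.
Proof. by rewrite mulr_sumr; apply: eq_bigr => i _; rewrite mxE mulrCA. Qed.

Lemma dotp0r u : dotp u 0 = 0.
Proof. by apply: big1 => i _; rewrite mxE mulr0. Qed.

Lemma dotpNr u x : dotp u (- x) = - dotp u x.
Proof. by rewrite -scaleN1r dotpZr mulN1r. Qed.

Lemma dotpBr u x y : dotp u (x - y) = dotp u x - dotp u y.
Proof. by rewrite dotpDr dotpNr. Qed.

Lemma dotpDl u v x : dotp (u + v) x = dotp u x + dotp v x.
Proof. by rewrite ![dotp _ x]dotpC dotpDr. Qed.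

Lemma dotpZl k u x : dotp (k *: u) x = k * dotp u x.
Proof. by rewrite ![dotp _ x]dotpC dotpZr. Qed.

Lemma dotpNl u x : dotp (- u) x = - dotp u x.
Proof. by rewrite ![dotp _ x]dotpC dotpNr. Qed.

Lemma dotpBl u v x : dotp (u - v) x = dotp u x - dotp v x.
Proof. by rewrite dotpDl dotpNl. Qed.

Lemma dotp_sumr (I : Type) (r : seq I) (Q : pred I) (F : I -> V) u :
  dotp u (\sum_(i <- r | Q i) F i) = \sum_(i <- r | Q i) dotp u (F i).
Proof. by apply: big_morph; [exact: dotpDr|exact: dotp0r]. Qed.

Lemma dotp_ge0 x : 0 <= dotp x x.
Proof. by apply: sumr_ge0 => i _; rewrite -expr2 sqr_ge0. Qed.

Lemma dotp_eq0 x : (dotp x x == 0) = (x == 0).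
Proof.
apply/idP/eqP => [|->]; last by rewrite dotp0r.
rewrite psumr_eq0 => [/allP h|i _]; last by rewrite -expr2 sqr_ge0.
apply/rowP => i; rewrite mxE; have := h i; rewrite mem_index_enum => /(_ isT).
by rewrite mulf_eq0 orbb => /eqP.
Qed.

Lemma dotp_gt0 x : x != 0 -> 0 < dotp x x.
Proof. by move=> x0; rewrite lt_def dotp_eq0 x0 dotp_ge0. Qed.

Lemma continuous_dotp (T : topologicalType) (f g : T -> V) :
  continuous f -> continuous g -> continuous (fun t => dotp (f t) (g t)).
Proof.
move=> cf cg; apply: (@continuous_sumr R R^o) => i t; apply: (@cvgM R).
  exact: (@continuous_comp _ _ _ f (fun M : V => M 0 i) t (cf t)
    (@coord_continuous _ _ _ _ _ _)).
exact: (@continuous_comp _ _ _ g (fun M : V => M 0 i) t (cg t)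
  (@coord_continuous _ _ _ _ _ _)).
Qed.

End Dotp.

(** The slope of [dotp z] along this line is positive. The lemma identifies the point where an edge
    meets a section. *)
Lemma line_dotp_inj (R : realType) d (z x y : 'rV[R]_d) (s t : R) :
  dotp z x < dotp z y ->
  dotp z (x + s *: (y - x)) = dotp z (x + t *: (y - x)) -> s = t.
Proof.
move=> xy; rewrite !dotpDr !dotpZr dotpBr => /addrI/mulIf; apply.
by rewrite subr_eq0 gt_eqF.
Qed.

(** * Extreme heights and widths in a direction *)

Section Extrema.
Variables (R : realType) (d : nat).
Local Notation V := 'rV[R]_d.
Implicit Types (A : set V) (x y z u v : V).

Lemma tmaxE A z x : A x -> (forall y, A y -> dotp z y <= dotp z x) ->
  tmax A z = dotp z x.
Proof.
move=> Ax h; apply/eqP; rewrite eq_le; apply/andP; split.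
  apply: ge_sup; first by exists (dotp z x); exists x.
  by move=> _ [y Ay <-]; exact: h.
apply: ub_le_sup; last by exists x.
by exists (dotp z x) => _ [y Ay <-]; exact: h.
Qed.

Lemma tminE A z x : A x -> (forall y, A y -> dotp z x <= dotp z y) ->
  tmin A z = dotp z x.
Proof.
move=> Ax h; apply/eqP; rewrite eq_le; apply/andP; split.
  apply: ge_inf; last by exists x.
  by exists (dotp z x) => _ [y Ay <-]; exact: h.
apply: lb_le_inf; first by exists (dotp z x); exists x.
by move=> _ [y Ay <-]; exact: h.
Qed.

Lemma segmentP (x y q : V) :
  segment x y q <-> exists s : R, [/\ 0 <= s, s <= 1 & q = x + s *: (y - x)].
Proof.
have E s : (1 - s) *: x + s *: y = x + s *: (y - x).
  by rewrite scalerBl scale1r scalerBr -addrA [- _ + _]addrC.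
split=> [[s /=]|[s [s0 s1 ->]]].
  by rewrite in_itv /= => /andP[s0 s1 <-]; exists s; rewrite E.
by exists s; rewrite ?E //= in_itv /= s0.
Qed.

Lemma segment_l (x y : V) : segment x y x.
Proof. by apply/segmentP; exists 0; rewrite scale0r addr0 ler01. Qed.

Lemma segment_r (x y : V) : segment x y y.
Proof. by apply/segmentP; exists 1; rewrite scale1r addrC subrK ler01. Qed.

Lemma segment_sym (x y : V) : segment x y = segment y x.
Proof.
suff S (a b : V) : segment a b `<=` segment b a by apply/seteqP; split; exact: S.
move=> _ /segmentP[s [s0 s1 ->]]; apply/segmentP; exists (1 - s).
split; rewrite ?subr_ge0 // ?gerBl //.
by rewrite scalerBl scale1r addrA addrCA subrr addr0 -scalerN opprB.
Qed.

Lemma segment_lo (x y z : V) : dotp z x <= dotp z y ->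
  (tmin (segment x y) z = dotp z x) * (tmax (segment x y) z = dotp z y).
Proof.
move=> xy; split.
  apply: tminE; first exact: segment_l.
  move=> _ /segmentP[s [s0 s1 ->]]; rewrite dotpDr dotpZr dotpBr.
  by rewrite lerDl mulr_ge0 // subr_ge0.
apply: tmaxE; first exact: segment_r.
move=> _ /segmentP[s [s0 s1 ->]]; rewrite dotpDr dotpZr dotpBr.
by rewrite -lerBrDl ler_piMl // subr_ge0.
Qed.

Lemma segment_width (x y z : V) :
  tmax (segment x y) z - tmin (segment x y) z = `|dotp z (y - x)|.
Proof.
case: (leP (dotp z x) (dotp z y)) => [xy|/ltW yx].
  by rewrite !segment_lo // dotpBr ger0_norm ?subr_ge0.
by rewrite segment_sym !segment_lo // dotpBr distrC ger0_norm ?subr_ge0.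
Qed.

Lemma interior_width A z : A° !=set0 -> z != 0 ->
  exists x y, [/\ A x, A y & dotp z x < dotp z y].
Proof.
move=> [x Ax] z0; exists x.
have cf : {for 0, continuous (fun s : R => x + s *: z)}.
  by apply: cvgD; [exact: cvg_cst|apply: cvgZr_tmp; exact: cvg_id].
have A0 : nbhs (x + (0 : R) *: z) A by rewrite scale0r addr0.
have /nbhs_ballP[e /= e0 he] := cf _ A0.
have Ae : A (x + (e / 2) *: z).
  apply: he; rewrite /ball /= sub0r normrN gtr0_norm ?divr_gt0 //.
  by rewrite ltr_pdivrMr // ltr_pMr // ltr1n.
exists (x + (e / 2) *: z); split => //; first exact: nbhs_singleton.
by rewrite dotpDr dotpZr ltrDl mulr_gt0 ?divr_gt0 ?dotp_gt0.
Qed.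

End Extrema.

(** * Compact sets: separation and existence of vertices *)

Section Compactness.
Variables (R : realType) (d : nat).
Local Notation V := 'rV[R]_d.
Implicit Types (K : set V) (x y z u v : V).

Definition segment_closed K :=
  forall x y (s : R), K x -> K y -> 0 <= s -> s <= 1 -> K (x + s *: (y - x)).

(** Hulls and zonotopes both have this form: [D] is the hyperplane of weights with sum 1 for a hull,
    the whole space for a zonotope. *)
Lemma compact_cube_image n (c : V) (p : 'I_n -> V) (D : set 'rV[R]_n) :
  closed D ->
  compact [set c + \sum_i w 0 i *: p i | w in
    [set w : 'rV[R]_n | forall i, `[0, 1]%classic (w 0 i)] `&` D].
Proof.
move=> cD; apply: continuous_compact; last first.
  apply: compact_closedI => //.
  apply: (@rV_compact R n (fun=> `[0, 1]%classic)) => _; exact: segment_compact.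
have cs : continuous (fun w : 'rV[R]_n => \sum_i w 0 i *: p i).
  apply: continuous_sumr => i t.
  have ci := @coord_continuous R 1 n 0 i t.
  exact: (@cvgZr_tmp R _ _ _ _ (fun w : 'rV[R]_n => w 0 i) _ (p i) ci).
apply: continuous_subspaceT => w; exact: (cvgD (cvg_cst c) (cs w)).
Qed.

(** The functional is [x - y0], with [y0] the point of [K] nearest to [x]: if
    [dotp (x - y0) (y - y0)] were positive for some [y] in [K], the segment from [y0] to [y] would
    contain a point nearer to [x]. *)
Lemma separation K x : compact K -> segment_closed K -> ~ K x ->
  exists u, forall y, K y -> dotp u y < dotp u x.
Proof.
move=> cK vK Kx; case: (pselect (K !=set0)) => [K0|K0]; last first.
  by exists 0 => y Ky; case: K0; exists y.
have cf : {within K, continuous (fun y => dotp (x - y) (x - y))}.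
  have cx : continuous (fun y : V => x - y).
    by move=> y; exact: (cvgD (cvg_cst x) (continuousN (@cvg_id _ (nbhs y)))).
  by apply: continuous_subspaceT; exact: continuous_dotp.
have [y0] := compact_EVT_min K0 cK cf; rewrite inE => Ky0 miny0.
have u0 : x - y0 != 0 by rewrite subr_eq0; apply/eqP => xy; rewrite xy in Kx.
exists (x - y0) => y Ky.
suff : dotp (x - y0) (y - y0) <= 0.
  by have := dotp_gt0 u0; rewrite !dotpBr; lra.
rewrite leNgt; apply/negP; set a := dotp _ _ => a0.
have := dotp_ge0 (y - y0); set c := dotp _ _ => c0.
have ac : 0 < a + c by lra.
(* A step [s] from [y0] towards [y] changes the squared distance to [x] by [s * (s * c - 2 * a)].
   This [s] gives [s * c < a], so the change is negative. *)
pose s := a / (a + c).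
have s0 : 0 < s by rewrite divr_gt0.
have s1 : s <= 1 by rewrite ler_pdivrMr //; lra.
have /miny0 : y0 + s *: (y - y0) \in K by rewrite inE; apply: vK => //; exact: ltW.
rewrite opprD addrA; move: @a @c @s a0 c0 ac s0 s1.
move: (x - y0) (y - y0) => u v a c s a0 c0 ac s0 s1.
rewrite dotpBr !dotpBl !dotpZl !dotpZr -/c [dotp v u]dotpC -/a.
have sac : s * (a + c) = a by rewrite /s divfK // gt_eqF.
nra.
Qed.

(** A point [x] of [K] farthest from the origin is the only maximizer of [dotp x] on [K]. *)
Lemma compact_has_vertex K : compact K -> K !=set0 -> vertices K !=set0.
Proof.
move=> cK K0.
have cf : {within K, continuous (fun y => dotp y y)}.
  by apply: continuous_subspaceT; apply: continuous_dotp => y; exact: cvg_id.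
have [x] := compact_EVT_max K0 cK cf; rewrite inE => Kx maxx.
have h y : K y -> dotp (x - y) (x - y) <= 2 * (dotp x x - dotp x y).
  rewrite -inE => /maxx; rewrite dotpBr !dotpBl [dotp y x]dotpC; lra.
exists x, x, (dotp x x); split=> [y Ky|].
  by have := h _ Ky; have := dotp_ge0 (x - y); lra.
apply/seteqP; split=> [_ -> //|y [Ky /= e]].
apply/esym/eqP; rewrite -subr_eq0 -dotp_eq0 eq_le dotp_ge0 andbT.
by rewrite (le_trans (h _ Ky)) // e subrr mulr0.
Qed.

End Compactness.

(** * Hulls of finite families and their faces *)

Section Hull.
Variables (R : realType) (d m : nat).
Local Notation V := 'rV[R]_d.
Variable p : 'I_m -> V.
Implicit Types (F : set V) (x y z u v : V) (w : 'I_m -> R).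
Local Notation P := (conv_hull p).

Lemma hullP x : P x <->
  exists w, [/\ forall i, 0 <= w i, \sum_i w i = 1 & x = \sum_i w i *: p i].
Proof.
by split=> [[w [w0 w1] <-]|[w [w0 w1 ->]]]; exists w => //; split.
Qed.

Lemma hull_gen i : P (p i).
Proof.
apply/hullP; exists (fun j => (j == i)%:R); split => [j||].
- exact: ler0n.
- by rewrite (bigD1 i) //= eqxx big1 ?addr0 // => j /negPf ->.
- rewrite (bigD1 i) //= eqxx scale1r big1 ?addr0 // => j /negPf ->.
  by rewrite scale0r.
Qed.

Lemma hull_convex : segment_closed P.
Proof.
move=> _ _ s /hullP[w [w0 w1 ->]] /hullP[w' [w'0 w'1 ->]] s0 s1.
apply/hullP; exists (fun i => w i + s * (w' i - w i)); split => [i||].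
- have := w0 i; have := w'0 i; nra.
- by rewrite big_split -mulr_sumr sumrB /= w1 w'1 subrr mulr0 addr0.
- rewrite -sumrB scaler_sumr -big_split; apply: eq_bigr => i _ /=.
  by rewrite scalerDl -scalerA scalerBl.
Qed.

Lemma hull_compact : compact P.
Proof.
rewrite (_ : P = [set 0 + \sum_i w 0 i *: p i | w in
    [set w : 'rV[R]_m | forall i, `[0, 1]%classic (w 0 i)] `&`
    [set w | \sum_i w 0 i = 1]]).
  apply: compact_cube_image.
  apply: (@preimage_closed _ _ (fun w : 'rV[R]_m => \sum_i w 0 i) [set x | x = 1]).
    move=> w _; apply: (@continuous_sumr R R^o) => i; exact: coord_continuous.
  exact: closed_eq.
apply/seteqP; split=> [_ /hullP[w [w0 w1 ->]]|_ [w [w0 /= w1] <-]].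
  exists (\row_i w i); last by rewrite add0r; apply: eq_bigr => i _; rewrite mxE.
  split=> [i|] /=; last by under eq_bigr do rewrite mxE.
  rewrite mxE in_itv /= w0 /= -w1 (bigD1 i) //= lerDl.
  by apply: sumr_ge0 => j _; exact: w0.
rewrite add0r; apply/hullP; exists (w 0); split => // i.
by have := w0 i; rewrite /= in_itv => /andP[].
Qed.

Lemma hull_le u b : (forall i, dotp u (p i) <= b) -> forall x, P x -> dotp u x <= b.
Proof.
move=> h _ /hullP[w [w0 w1 ->]]; rewrite dotp_sumr -[b]mul1r -w1 mulr_suml.
by apply: ler_sum => i _; rewrite dotpZr ler_wpM2l.
Qed.

(** The nonnegative terms [w i * (b - dotp u (p i))] sum to zero, so each of them vanishes. *)
Lemma face_support u b w : (forall i, dotp u (p i) <= b) ->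
  (forall i, 0 <= w i) -> \sum_i w i = 1 -> dotp u (\sum_i w i *: p i) = b ->
  forall i, w i != 0 -> dotp u (p i) = b.
Proof.
move=> h w0 w1 e i wi.
have : \sum_i w i * (b - dotp u (p i)) = 0.
  under eq_bigr do rewrite mulrBr -dotpZr.
  by rewrite sumrB -mulr_suml w1 mul1r -dotp_sumr e subrr.
move/eqP; rewrite psumr_eq0 => [/allP/(_ i)|j _]; last by rewrite mulr_ge0 ?subr_ge0.
by rewrite mem_index_enum mulf_eq0 (negPf wi) subr_eq0 => /(_ isT)/eqP.
Qed.

Lemma faceP F : face P F -> exists u b,
  (forall i, dotp u (p i) <= b) /\ F = P `&` [set x | dotp u x = b].
Proof.
by move=> [u [b [h ->]]]; exists u, b; split => // i; apply/h/hull_gen.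
Qed.

Lemma face_hull F x : face P F -> F x -> exists w,
  [/\ forall i, 0 <= w i, \sum_i w i = 1, x = \sum_i w i *: p i
    & forall i, w i != 0 -> F (p i)].
Proof.
move=> /faceP[u [b [h ->]]] [/hullP[w [w0 w1 ->]] /= e].
by exists w; split => // i wi; split; [exact: hull_gen|exact: face_support wi].
Qed.

Lemma face_convex F : face P F -> segment_closed F.
Proof.
move=> /faceP[u [b [_ ->]]] x y s [Px /= ux] [Py /= uy] s0 s1.
split; first exact: hull_convex.
by rewrite /= dotpDr dotpZr dotpBr ux uy subrr mulr0 addr0.
Qed.

(** A face is the hull of the generators it contains, so it is determined by a subset of the
    indices. *)
Lemma faces_finite : finite_set [set F | face P F].
Proof.
pose f (S : {set 'I_m}) := [set \sum_i w i *: p i | w in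
  [set w | [/\ forall i, 0 <= w i, \sum_i w i = 1
    & forall i, w i != 0 -> i \in S]]].
apply: (@sub_finite_set _ _ (f @` setT)); last first.
  by apply: finite_image; exact: finite_finset.
move=> F /faceP[u [b [h ->]]]; exists [set i | dotp u (p i) == b]%SET => //.
apply/seteqP; split=> [_ [w [w0 w1 wS] <-]|_ [/hullP[w [w0 w1 ->]] /= e]].
  split; first by apply/hullP; exists w.
  rewrite /= dotp_sumr -[b]mul1r -w1 mulr_suml; apply: eq_bigr => i _.
  rewrite dotpZr; have [->|/wS] := eqVneq (w i) 0; first by rewrite !mul0r.
  by rewrite inE => /eqP ->.
exists w => //; split => // i wi; rewrite inE; apply/eqP.
exact: face_support wi.
Qed.

Lemma edges_finite : finite_set (edges P).
Proof. by apply: sub_finite_set faces_finite => F []. Qed.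

End Hull.

(** * Edges and their crossings with a hyperplane *)

Section Edges.
Variables (R : realType) (d : nat).
Local Notation V := 'rV[R]_d.
Implicit Types (F : set V) (x y z u v q r : V).

Lemma has_dim1_line F : has_dim F 1 -> exists v x y,
  [/\ v != 0, F x, F y, x != y & forall x y, F x -> F y -> y - x \in <[v]>%VS].
Proof.
move=> [U [dU U1]].
have U0 : U != 0%VS by rewrite -dimv_eq0 U1.
have UE : U = <[vpick U]>%VS.
  apply/eqP; rewrite eq_sym eqEdim -memvE memv_pick U1 dim_vline.
  by rewrite vpick0 U0.
have FU x y : F x -> F y -> y - x \in U by move: x y; apply/(dU U).
exists (vpick U); case: (pselect (exists x y, [/\ F x, F y & x != y])).
  by move=> [x [y [Fx Fy xy]]]; exists x, y; split=> //; rewrite ?vpick0 // -UE.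
move=> Fn; case/negP: U0; rewrite -subv0; apply/(dU 0%VS) => x y Fx Fy.
rewrite memv0 subr_eq0 eq_sym; apply/negPn/negP => xy.
by case: Fn; exists x, y.
Qed.

Lemma has_dim1 F q r : F q -> F r -> q != r ->
  (forall x, F x -> x - q \in <[r - q]>%VS) -> has_dim F 1.
Proof.
move=> Fq Fr qr h; exists <[r - q]>%VS; split; last first.
  by rewrite dim_vline subr_eq0 eq_sym qr.
move=> W; split=> [sW x y Fx Fy|/(_ q r Fq Fr)]; last by rewrite memvE.
apply: (subvP sW); rewrite -[y](subrK q) -addrA -[q - x]opprB.
by rewrite rpredB // h.
Qed.

Lemma convex_cross (K : set V) z t q r : segment_closed K -> K q -> K r ->
  dotp z q < t -> t < dotp z r ->
  exists s : R, [/\ 0 < s, s < 1, dotp z (q + s *: (r - q)) = t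
    & K (q + s *: (r - q))].
Proof.
move=> cK Kq Kr qt tr; exists ((t - dotp z q) / (dotp z r - dotp z q)).
have D0 : 0 < dotp z r - dotp z q by lra.
have s0 : 0 < (t - dotp z q) / (dotp z r - dotp z q) by rewrite divr_gt0 // subr_gt0.
have s1 : (t - dotp z q) / (dotp z r - dotp z q) < 1 by rewrite ltr_pdivrMr //; lra.
split => //; last exact: cK Kq Kr (ltW s0) (ltW s1).
by rewrite dotpDr dotpZr dotpBr divfK ?gt_eqF //; lra.
Qed.

Lemma face_refl (A : set V) : face A A.
Proof.
exists 0, 0; split => [y _|]; first by rewrite dotpC dotp0r.
by apply/seteqP; split=> [y Py|y []] //; split => //=; rewrite dotpC dotp0r.
Qed.

Section HullEdges.
Variables (m : nat) (p : 'I_m -> V).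
Local Notation P := (conv_hull p).

Lemma face_le F u b : face P F -> (forall i, F (p i) -> dotp u (p i) <= b) ->
  forall x, F x -> dotp u x <= b.
Proof.
move=> fF h x /(face_hull fF)[w [w0 w1 -> wF]].
rewrite dotp_sumr -[b]mul1r -w1 mulr_suml; apply: ler_sum => i _.
rewrite dotpZr; have [->|/wF/h] := eqVneq (w i) 0; first by rewrite !mul0r.
by move=> ?; rewrite ler_wpM2l.
Qed.

Lemma face_ge F u b : face P F -> (forall i, F (p i) -> b <= dotp u (p i)) ->
  forall x, F x -> b <= dotp u x.
Proof.
move=> fF h x Fx; rewrite -lerN2 -dotpNl; apply: face_le fF _ _ Fx => i Fi.
by rewrite dotpNl lerN2 h.
Qed.

Lemma face_gen F x : face P F -> F x -> exists i, F (p i).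
Proof.
move=> fF /(face_hull fF)[w [w0 w1 _ wF]].
case: (pselect (exists i, w i != 0)) => [[i /wF]|n]; first by exists i.
move: w1; rewrite big1 => [/esym/eqP|i _]; first by rewrite oner_eq0.
by apply/eqP/negPn/negP => wi; case: n; exists i.
Qed.

(** Otherwise all generators in [F] lie above height [t], and so does their convex combination
    [x]. *)
Lemma face_gen_lt F x z t : face P F -> F x -> dotp z x = t ->
  (forall i, dotp z (p i) != t) -> exists i, F (p i) /\ dotp z (p i) < t.
Proof.
move=> fF Fx zx zp; apply: contrapT => n.
have tp i : F (p i) -> t < dotp z (p i).
  move=> Fi; rewrite lt_def zp leNgt; apply/negP => lt.
  by apply: n; exists i.
have [w [w0 w1 xE wF]] := face_hull fF Fx.
suff w00 i : w i = 0 by move: w1; rewrite big1 // => /esym/eqP; rewrite oner_eq0.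
have : \sum_i w i * (dotp z (p i) - t) = 0.
  under eq_bigr do rewrite mulrBr -dotpZr.
  by rewrite sumrB -mulr_suml w1 mul1r -dotp_sumr -xE zx subrr.
move/eqP; rewrite psumr_eq0 => [/allP/(_ i)|j _].
  by rewrite mem_index_enum mulf_eq0 subr_eq0 (negPf (zp i)) orbF => /(_ isT)/eqP.
have [->|/wF/tp h] := eqVneq (w j) 0; first by rewrite mul0r.
by rewrite mulr_ge0 // subr_ge0 ltW.
Qed.

Lemma face_gen_gt F x z t : face P F -> F x -> dotp z x = t ->
  (forall i, dotp z (p i) != t) -> exists i, F (p i) /\ t < dotp z (p i).
Proof.
move=> fF Fx zx zp.
have [|i|i [Fi lt]] := @face_gen_lt F x (- z) (- t) fF Fx.
- by rewrite dotpNl zx.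
- by rewrite dotpNl eqr_opp.
- by exists i; split => //; move: lt; rewrite dotpNl ltrN2.
Qed.

(** If [v] directs the edge, [dotp v] is injective on [F], so the ends are the generators in [F]
    where [dotp v] is least and greatest. The vector [z] fixes the order of the ends. *)
Lemma edge_segment F z : edges P F -> exists i j,
  [/\ p i != p j, dotp z (p i) <= dotp z (p j) & F = segment (p i) (p j)].
Proof.
move=> [fF /has_dim1_line[v [x0 [y0 [v0 Fx0 Fy0 xy0 Fv]]]]].
suff [i [j [pij FE]]] : exists i j, p i != p j /\ F = segment (p i) (p j).
  case: (leP (dotp z (p i)) (dotp z (p j))) => [le|/ltW le]; first by exists i, j.
  by exists j, i; split => //; rewrite 1?eq_sym // segment_sym.
have [k Fk] := face_gen fF Fx0.
pose Q i := `[< F (p i) >].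
have Qk : Q k by apply/asboolP.
have [i /asboolP Fi mini] := @arg_minP _ _ _ k Q (fun i => dotp v (p i)) Qk.
have [j /asboolP Fj maxj] := @arg_maxP _ _ _ k Q (fun i => dotp v (p i)) Qk.
have vi x : F x -> dotp v (p i) <= dotp v x.
  by apply: face_ge fF _ _ => l Fl; apply/mini/asboolP.
have vj x : F x -> dotp v x <= dotp v (p j).
  by apply: face_le fF _ _ => l Fl; apply/maxj/asboolP.
have vv := dotp_gt0 v0.
have inj x y : F x -> F y -> dotp v x = dotp v y -> x = y.
  move=> Fx Fy e; have /vlineP[k' kE] := Fv _ _ Fx Fy.
  have : dotp v (y - x) = 0 by rewrite dotpBr e subrr.
  rewrite kE dotpZr => /eqP; rewrite mulf_eq0 (gt_eqF vv) orbF => /eqP k0.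
  by apply/esym/eqP; rewrite -subr_eq0 kE k0 scale0r.
have ltij : dotp v (p i) < dotp v (p j).
  rewrite lt_neqAle vi // andbT; apply/negP => /eqP e; case/negP: xy0.
  have c x : F x -> dotp v x = dotp v (p i).
    by move=> Fx; apply/eqP; rewrite eq_le (vi _ Fx) e vj.
  by apply/eqP/inj => //; rewrite !c.
exists i, j; split; first by apply: contraTneq ltij => ->; rewrite ltxx.
apply/seteqP; split=> [x Fx|_ /segmentP[s [s0 s1 ->]]]; last first.
  exact: face_convex fF _ _ _ Fi Fj s0 s1.
have D0 : 0 < dotp v (p j) - dotp v (p i) by rewrite subr_gt0.
pose s := (dotp v x - dotp v (p i)) / (dotp v (p j) - dotp v (p i)).
have s0 : 0 <= s by apply: divr_ge0; [rewrite subr_ge0 vi|exact: ltW].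
have s1 : s <= 1 by rewrite ler_pdivrMr // mul1r lerB // vj.
apply/segmentP; exists s; split => //; apply: inj => //.
  exact: face_convex fF _ _ _ Fi Fj s0 s1.
by rewrite dotpDr dotpZr dotpBr divfK ?gt_eqF // addrC subrK.
Qed.

Section GenericSection.
Variables (z : V) (t : R).
Hypothesis zp : forall i, dotp z (p i) != t.

Lemma edge_cross F x : edges P F -> F x -> dotp z x = t ->
  exists i j (s : R), [/\ F = segment (p i) (p j), dotp z (p i) < t < dotp z (p j),
    0 < s < 1 & x = p i + s *: (p j - p i)].
Proof.
move=> eF Fx zx; have [i [j [_ le FE]]] := edge_segment z eF.
move: Fx; rewrite FE => /segmentP[s [s0 s1 xE]]; exists i, j, s; split => //.
  have : dotp z (p i) <= t.
    rewrite -zx xE dotpDr dotpZr dotpBr; nra.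
  have : t <= dotp z (p j).
    rewrite -zx xE dotpDr dotpZr dotpBr; nra.
  by rewrite !lt_def zp eq_sym zp => -> ->.
rewrite !lt_def s0 s1 !andbT; apply/andP; split; apply/negP => /eqP e.
  by move: (zp i); rewrite -zx xE e scale0r addr0 eqxx.
by move: (zp j); rewrite -zx xE -e scale1r addrC subrK eqxx.
Qed.

Lemma edge_cross_tmin_tmax F x : edges P F -> F x -> dotp z x = t ->
  tmin F z < t < tmax F z.
Proof.
move=> eF Fx zx; have [i [j [s [-> /andP[it tj] _ _]]]] := edge_cross eF Fx zx.
by rewrite !segment_lo ?it //; exact/ltW/(lt_trans it).
Qed.

Lemma tmin_tmax_edge_cross F : edges P F -> tmin F z < t < tmax F z ->
  exists x, F x /\ dotp z x = t.
Proof.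
move=> eF; have [i [j [_ le FE]]] := edge_segment z eF.
rewrite [in X in X -> _]FE !segment_lo // => /andP[it tj].
have cF := face_convex (proj1 eF).
have Fi : F (p i) by rewrite FE; exact: segment_l.
have Fj : F (p j) by rewrite FE; exact: segment_r.
have [s [_ _ h1 h2]] := convex_cross cF Fi Fj it tj.
by exists (p i + s *: (p j - p i)).
Qed.

(** The common point is relatively interior to [F]. The functional that cuts out [F'] is maximal
    there, hence constant on [F], which puts [F] inside [F']; then the roles are exchanged. *)
Lemma edge_cross_inj F F' x : edges P F -> edges P F' -> F x -> F' x ->
  dotp z x = t -> F = F'.
Proof.
suff S A B : edges P A -> edges P B -> A x -> B x -> dotp z x = t -> A `<=` B.
  by move=> ? ? ? ? ?; apply/seteqP; split; apply: S.
move=> eA eB Ax Bx zx.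
have [i [j [s [-> _ /andP[s0 s1] xE]]]] := edge_cross eA Ax zx.
have cB := face_convex (proj1 eB).
have [u [b [h BE]]] := faceP (proj1 eB).
have ux : dotp u x = b by move: Bx; rewrite BE => -[].
have := h i; have := h j; move: ux; rewrite xE dotpDr dotpZr dotpBr => ux hj hi.
have Bi : B (p i) by rewrite BE; split; [exact: hull_gen|rewrite /=; nra].
have Bj : B (p j) by rewrite BE; split; [exact: hull_gen|rewrite /=; nra].
by move=> _ /segmentP[s' [s'0 s'1 ->]]; exact: cB.
Qed.

(** The functional that cuts out the edge also supports the section, and the edge has a single point
    at height [t]. *)
Lemma edge_section_vertex F x : edges P F -> F x -> dotp z x = t ->
  vertices (section P z t) x.
Proof.
move=> eF Fx zx; have [u [b [h FE]]] := faceP (proj1 eF).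
exists u, b; split; first by move=> y [Py _]; exact: hull_le h _ Py.
apply/seteqP; split=> [_ ->|y [[Py /= zy] uy]].
  by move: Fx; rewrite FE => -[].
have Fy : F y by rewrite FE.
have [i [j [s [E /andP[it tj] _ xE]]]] := edge_cross eF Fx zx.
move: Fy; rewrite E => /segmentP[s' [_ _ yE]]; rewrite xE yE.
congr (_ + _ *: _); apply: (@line_dotp_inj _ _ z (p i) (p j)).
  exact: lt_trans it tj.
by rewrite -xE -yE zx.
Qed.

(* The section has a support plane [u = b] at its vertex [x]; tilting it by a
   suitable multiple of [z] makes it support the whole of [P], and then it cuts
   out an edge. *)
Lemma section_vertex_edge x : vertices (section P z t) x ->
  exists F, [/\ edges P F, F x & dotp z x = t].
Proof.
move=> [u [b [h xE]]].
have uniq y : P y -> dotp z y = t -> dotp u y = b -> y = x.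
  by move=> Py zy uy; suff : [set x] y by []; rewrite xE.
have [[Px /= zx] ux] : (section P z t `&` [set x | dotp u x = b]) x by rewrite -xE.
have [i0 [_ i0t]] := face_gen_lt (face_refl P) Px zx zp.
(* [g] is the height above the hyperplane and [k] the slack of [u <= b], possibly negative off the
   section. Tilting [u] by [s *: z] supports [P] once [s * g j <= k j] for all [j]. *)
pose g i := dotp z (p i) - t; pose k i := b - dotp u (p i).
(* The segment from [p i] to [p j] crosses the section, where [u <= b]. Hence each ratio [k / g]
   below the hyperplane is at most each ratio above it, and the largest one from below is an
   admissible tilt. *)
have gk i j : g i < 0 -> 0 < g j -> k j * g i <= k i * g j.
  rewrite subr_lt0 subr_gt0 => it tj.
  have [s [s0 s1 zs Ps]] :=
    convex_cross (hull_convex (p := p)) (hull_gen p i) (hull_gen p j) it tj.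
  have : dotp u (p i + s *: (p j - p i)) <= b by apply: h; split.
  move: zs; rewrite !dotpDr !dotpZr !dotpBr /g /k => e.
  have -> : t = dotp z (p i) + s * (dotp z (p j) - dotp z (p i)) by [].
  nra.
have [i gi maxi] := @arg_maxP _ _ _ i0 (fun i => g i < 0) (fun i => k i / g i)
  ltac:(by rewrite /= subr_lt0).
pose s := k i / g i.
have sg j : s * g j <= k j.
  have : g j != 0 by rewrite subr_eq0.
  case: (ltgtP (g j) 0) => // gj _.
    by rewrite -ler_ndivrMr //; exact: maxi.
  by rewrite /s mulrAC ler_ndivrMr // gk.
pose u' := u + s *: z; pose b' := b + s * t.
pose F := P `&` [set y | dotp u' y = b'].
have fF : face P F.
  exists u', b'; split => //; apply: hull_le => j.
  by have := sg j; rewrite /g /k dotpDl dotpZl /b'; nra.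
have Fx : F x by split => //=; rewrite dotpDl dotpZl zx ux.
have Funiq y : F y -> dotp z y = t -> y = x.
  move=> [Py /=]; rewrite dotpDl dotpZl => + zy.
  by rewrite zy => /addIr; exact: uniq.
have cF := face_convex fF.
have [l [Fl lt]] := face_gen_lt fF Fx zx zp.
have [r [Fr tr]] := face_gen_gt fF Fx zx zp.
exists F; split => //; split => //.
have [s1 [s10 s11 zs1 /Funiq/(_ zs1) xs1]] := convex_cross cF Fl Fr lt tr.
have lr : p l != p r.
  by apply: contraTneq lt => ->; rewrite -leNgt ltW.
(* If [y] is off the hyperplane, the segment joining it to [p l] or [p r], whichever is on the other
   side, crosses the section within [F], hence at [x]. So [y] is on the line through [p l] and
   [p r]. *)
apply: (has_dim1 Fl Fr lr) => y Fy.
have xl : x - p l \in <[p r - p l]>%VS.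
  by rewrite -xs1 addrAC subrr add0r memvZ // memv_line.
have [yt|ty|yt] := ltgtP (dotp z y) t; last by rewrite (Funiq y).
  have [s2 [s20 s21 zs2 /Funiq/(_ zs2) xs2]] := convex_cross cF Fy Fr yt tr.
  have : (1 - s2) *: (y - p l) \in <[p r - p l]>%VS.
    have -> : (1 - s2) *: (y - p l) = (x - p l) - s2 *: (p r - p l).
      rewrite -xs2; apply/rowP => c; rewrite !mxE; ring.
    by rewrite rpredB // memvZ // memv_line.
  move=> /(memvZ (1 - s2)^-1); rewrite scalerA mulVf ?scale1r //.
  by rewrite subr_eq0 gt_eqF.
have [s2 [s20 s21 zs2 /Funiq/(_ zs2) xs2]] := convex_cross cF Fl Fy lt ty.
have : s2 *: (y - p l) \in <[p r - p l]>%VS.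
  by rewrite (_ : s2 *: _ = x - p l) // -xs2 addrAC subrr add0r.
by move=> /(memvZ s2^-1); rewrite scalerA mulVf ?scale1r // gt_eqF.
Qed.

End GenericSection.
End HullEdges.
End Edges.

(** * Integrals of step functions *)

Section StepFunctions.
Variable R : realType.
Local Notation mu := (@lebesgue_measure R).

(** The booleans cover both the open intervals that count edges and the degenerate closed ones that
    change a function at single points. *)
Lemma Rintegral_step (I : Type) (r : seq I) (c lo hi : I -> R) (a b : R)
    (b0 b1 : bool) :
  (forall i, [/\ a <= lo i, lo i <= hi i & hi i <= b]) ->
  let f t := \sum_(i <- r)
    c i * \1_([set` Interval (BSide b0 (lo i)) (BSide b1 (hi i))]) t in
  mu.-integrable `[a, b] (EFin \o f) /\
  \int[mu]_(t in `[a, b]) f t = \sum_(i <- r) c i * (hi i - lo i).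
Proof.
move=> h; have mD : measurable (`[a, b]%classic : set (measurableTypeR R)).
  exact: measurable_itv.
elim: r => [|i r [IH1 IH2]] f.
  split; last by rewrite big_nil /f; under eq_Rintegral do rewrite big_nil;
    rewrite Rintegral_cst // mul0r.
  rewrite (_ : _ \o _ = cst 0%E); first exact: integrable0.
  by apply/funext => t; rewrite /f /= big_nil.
set A := [set` Interval (BSide b0 (lo i)) (BSide b1 (hi i))].
have [a1 l1 b1'] := h i.
have I1 : mu.-integrable `[a, b] (EFin \o (\1_A : R -> R)).
  by apply: integrableS (integrable_indic_itv (lo i) (hi i) b0 b1).
have I2 : mu.-integrable `[a, b] (EFin \o (fun t => c i * \1_A t)).
  exact: (integrableZl mD (c i) I1).
have fE t : f t = c i * \1_A t + \sum_(j <- r)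
    c j * \1_([set` Interval (BSide b0 (lo j)) (BSide b1 (hi j))]) t.
  by rewrite /f big_cons.
split.
  apply: (eq_integrable mD _ _ _ (integrableD mD I2 IH1)) => t _.
  by rewrite /= fE EFinD.
under eq_Rintegral do rewrite fE.
rewrite RintegralD // IH2 big_cons RintegralZl //; congr (_ * _ + _).
have muA : mu A = (hi i - lo i)%:E.
  rewrite /A lebesgue_measure_itv /= lte_fin.
  by case: ltgtP l1 => // -> _; rewrite subrr.
rewrite /Rintegral integral_indic //; last exact: measurable_itv.
have -> : A `&` `[a, b] = A.
  apply/seteqP; split=> [x []//|x Ax]; split; first exact: Ax.
  move: Ax.
  rewrite /A /= !itv_boundlr /= !bnd_simp => /andP[u v]; apply/andP; split.
    by apply: le_trans a1 _; case: (b0) u; rewrite bnd_simp // => /ltW.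
  by apply: le_trans b1'; case: (b1) v; rewrite bnd_simp // => /ltW.
exact: (congr1 fine muA).
Qed.

(* The exceptional set [N] absorbs the sections through vertices, where nothing
   is known about the integrand. *)
Lemma Rintegral_generic (I : Type) (r : seq I) (lo hi : I -> R) (a b : R)
    (N : seq R) (f : R -> R) :
  (forall i, [/\ a <= lo i, lo i <= hi i & hi i <= b]) ->
  (forall t, t \notin N -> f t = \sum_(i <- r) (lo i < t < hi i)%R%:R) ->
  \int[mu]_(t in `[a, b]) f t = \sum_(i <- r) (hi i - lo i).
Proof.
move=> h fE; have mD : measurable (`[a, b]%classic : set (measurableTypeR R)).
  exact: measurable_itv.
pose g t : R := \sum_(i <- r) 1 * \1_(`]lo i, hi i[%classic) t.
have gE t : t \notin N -> f t = g t.
  move=> /fE ->; apply: eq_bigr => i _.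
  by rewrite mul1r indicE mem_setE in_itv.
pose N' := [seq x <- undup N | a <= x <= b].
have uN : uniq N' by rewrite filter_uniq ?undup_uniq.
have N'P x : x \in N' -> a <= x <= b by rewrite mem_filter => /andP[].
pose k (x : seq_sub N') : R := val x.
(* [e] corrects [g] at the finitely many exceptional points of [[a, b]]. Its integral is zero, and
   [f = g + e] on [[a, b]] is a step function. *)
pose e (t : R) : R := \sum_(x <- index_enum (seq_sub N'))
  (f (k x) - g (k x)) * \1_(`[k x, k x]%classic) t.
have [ig Ig] := @Rintegral_step I r (fun=> 1) lo hi a b false true h.
have h' (x : seq_sub N') : [/\ a <= k x, k x <= k x & k x <= b].
  by have /andP[] := N'P _ (valP x).
have [ie Ie] := @Rintegral_step _ (index_enum (seq_sub N'))
  (fun x => f (k x) - g (k x)) k k a b true false h'.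
have k1 (x : seq_sub N') t : (\1_(`[k x, k x]%classic) t : R) = (t == k x)%:R.
  by rewrite indicE mem_setE in_itv /= eq_le andbC.
have fge t : t \in (`[a, b]%classic : set R) -> f t = g t + e t.
  rewrite mem_setE in_itv /= => tab; rewrite /e; have [tN|tN] := boolP (t \in N).
    have tN' : t \in N' by rewrite mem_filter tab mem_undup.
    rewrite (bigD1 (SeqSub tN')) //= big1 ?addr0 => [|x xt].
      by rewrite k1 eqxx mulr1 addrC subrK.
    by rewrite k1 -[t]/(k (SeqSub tN')) eq_sym (inj_eq val_inj) (negPf xt) mulr0.
  rewrite big1 ?addr0 ?gE // => x _; rewrite k1.
  case: eqVneq => [tx|]; last by rewrite mulr0.
  by move: (valP x); rewrite -/(k x) -tx mem_filter mem_undup (negPf tN) andbF.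
transitivity (\int[mu]_(t in `[a, b]) (g t + e t)); first exact: eq_Rintegral.
rewrite RintegralD // Ig Ie [X in _ + X]big1.
  by rewrite addr0; apply: eq_bigr => i _; rewrite mul1r.
by move=> x _; rewrite subrr mulr0.
Qed.

End StepFunctions.

(** * Finite counting and avoidance of finitely many values *)

Lemma ncard_setI (T : choiceType) (A B : set T) : finite_set A ->
  ncard (A `&` B) = (\sum_(x <- fset_set A) (x \in B))%N.
Proof.
move=> fA; rewrite -big_mkcond sum1_count -size_filter /ncard.
apply/perm_size/uniq_perm; rewrite ?filter_uniq ?fset_uniq // => x.
rewrite mem_filter in_fset_set ?in_fset_set //; last by apply: finite_setI; left.
by rewrite in_setI andbC.
Qed.

Lemma ncard_image (T U : choiceType) (f : T -> U) (A : set T) : finite_set A ->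
  {in A &, injective f} -> ncard (f @` A) = ncard A.
Proof.
move=> fA inj; rewrite /ncard fset_set_image // card_in_imfset // => x y.
by rewrite !in_fset_set //; exact: inj.
Qed.

(** Induction on [N] maintains an open subinterval free of the points seen so far, cut at each new
    point that it contains. Its midpoint is the witness. *)
Lemma itv_avoid (R : realType) (N : seq R) (a b : R) : a < b ->
  exists t, a < t < b /\ t \notin N.
Proof.
suff h : a < b -> exists a' b', [/\ a <= a', a' < b', b' <= b &
    forall y, y \in N -> ~~ (a' < y < b')].
  move=> /h[a' [b' [aa' ab' bb' h']]]; exists ((a' + b') / 2).
  have m : a' < (a' + b') / 2 < b' by apply/andP; split; lra.
  move/andP: (m) => [m1 m2]; rewrite (le_lt_trans aa' m1) (lt_le_trans m2) //.
  by split => //; apply/negP => /h'; rewrite m.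
move=> ab; elim: N => [|x N [a' [b' [aa' ab' bb' IH]]]]; first by exists a, b.
case: (boolP (a' < x < b')) => [/andP[ax xb]|nx].
  exists a', x; split => // [|y]; first exact: le_trans (ltW xb) bb'.
  rewrite in_cons => /predU1P[->|/IH]; first by rewrite ltxx andbF.
  by apply: contra => /andP[-> /= yx]; exact: lt_trans yx xb.
by exists a', b'; split => // y; rewrite in_cons => /predU1P[->|/IH].
Qed.

(** * The average vertex count as a sum of edge widths *)

Section Average.
Variables (R : realType) (d m : nat) (p : 'I_m -> 'rV[R]_d).
Local Notation V := 'rV[R]_d.
Local Notation P := (conv_hull p).
Implicit Types (F : set V) (x y z : V) (t : R).

(** Sending an edge to its point at height [t] is a bijection from the edges straddling [t] onto the
    vertices of the section. *)
Lemma ncard_section_vertices z t : (forall i, dotp z (p i) != t) ->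
  ncard (vertices (section P z t)) =
  (\sum_(F <- fset_set (edges P)) (tmin F z < t < tmax F z)%R)%N.
Proof.
move=> zp; pose g F := xget 0 (F `&` [set x | dotp z x = t]).
pose E := edges P `&` [set F | tmin F z < t < tmax F z].
have gP F : E F -> F (g F) /\ dotp z (g F) = t.
  move=> [eF /(tmin_tmax_edge_cross eF)[x [Fx zx]]].
  have : (F `&` [set x | dotp z x = t]) (g F) by apply: (@xgetI _ _ _ x).
  by [].
have -> : vertices (section P z t) = g @` E.
  apply/seteqP; split=> [x xv|_ [F EF <-]]; last first.
    by have [Fg zg] := gP _ EF; exact (edge_section_vertex zp (proj1 EF) Fg zg).
  have [F [eF Fx zx]] := section_vertex_edge zp xv.
  have EF : E F by split => //; exact (edge_cross_tmin_tmax zp eF Fx zx).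
  have [Fg zg] := gP _ EF; exists F => //.
  have [i [j [s [E1 /andP[it tj] _ xE]]]] := edge_cross zp eF Fx zx.
  have /segmentP[s' [_ _ gE]] : segment (p i) (p j) (g F) by rewrite -E1.
  rewrite xE gE; congr (_ + _ *: _).
  apply: (@line_dotp_inj _ _ z (p i) (p j)); first exact: lt_trans it tj.
  by rewrite -xE -gE zx zg.
rewrite ncard_image; last 2 first.
- by apply: finite_setI; left; exact: edges_finite.
- move=> F F'; rewrite !inE => EF EF' e.
  have [Fg zg] := gP _ EF; have [Fg' _] := gP _ EF'.
  case: EF EF' => eF _ [eF' _]; apply: (edge_cross_inj zp eF eF' Fg _ zg).
  by rewrite e.
rewrite ncard_setI; last exact: edges_finite.
by apply: eq_bigr => F _; rewrite mem_setE.
Qed.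

Lemma hull_tmax z : P !=set0 ->
  (exists i, tmax P z = dotp z (p i)) /\ forall x, P x -> dotp z x <= tmax P z.
Proof.
move=> [x Px]; have [k _] := face_gen (face_refl P) Px.
have [i _ maxi] := @arg_maxP _ _ _ k xpredT (fun i => dotp z (p i)) isT.
have h y : P y -> dotp z y <= dotp z (p i) by apply: hull_le => j; exact: maxi.
by rewrite (tmaxE (hull_gen p i) h); split => //; exists i.
Qed.

Lemma tminN (A : set V) z : tmin A z = - tmax A (- z).
Proof.
rewrite /tmin /tmax /inf; congr (- sup _); apply/seteqP; split=> x /=.
  by move=> [_ [y Ay <-] <-]; exists y; rewrite // dotpNl.
by move=> [y Ay <-]; exists (dotp z y); [exists y|rewrite dotpNl].
Qed.

Lemma hull_tmin z : P !=set0 ->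
  (exists i, tmin P z = dotp z (p i)) /\ forall x, P x -> tmin P z <= dotp z x.
Proof.
move=> P0; have [[i iE] h] := hull_tmax (- z) P0; rewrite tminN; split.
  by exists i; rewrite iE dotpNl opprK.
by move=> x /h; rewrite dotpNl lerNl.
Qed.

Lemma edge_tmin_tmax F z : edges P F ->
  [/\ tmin P z <= tmin F z, tmin F z <= tmax F z & tmax F z <= tmax P z].
Proof.
move=> /edge_segment-/(_ z)[i [j [_ le ->]]]; rewrite !segment_lo //.
have P0 : P !=set0 by exists (p i); exact: hull_gen.
by split => //; [apply (hull_tmin z P0).2|apply (hull_tmax z P0).2]; exact: hull_gen.
Qed.

(** Away from the heights of generators, an edge is counted exactly while [t] is strictly between
    its extreme heights, so it contributes its width to the integral. *)
Lemma avg_vertices_edges z : P !=set0 -> avg_vertices P z =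
  (tmax P z - tmin P z)^-1 *
  \sum_(F <- fset_set (edges P)) (tmax F z - tmin F z).
Proof.
move=> P0; congr (_ * _).
(* For a set that is not an edge the interval collapses to [tmin P z], so that the required bounds
   hold at every index. *)
pose lo F := if F \in edges P then tmin F z else tmin P z.
pose hi F := if F \in edges P then tmax F z else tmin P z.
have eE F : F \in fset_set (edges P) -> F \in edges P.
  by rewrite in_fset_set //; exact: edges_finite.
transitivity (\sum_(F <- fset_set (edges P)) (hi F - lo F)); last first.
  by apply: eq_big_seq => F /eE eF; rewrite /hi /lo eF.
apply: (@Rintegral_generic _ _ _ lo hi _ _ [seq dotp z (p i) | i : 'I_m]).
  move=> F; rewrite /lo /hi; case: ifPn => [|_].
    by rewrite inE; exact: edge_tmin_tmax.
  split => //; have [[i ->] _] := hull_tmin z P0.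
  by apply (hull_tmax z P0).2; exact: hull_gen.
move=> t tN; rewrite ncard_section_vertices => [|i]; last first.
  by apply: contraNneq tN => <-; apply/mapP; exists i => //; exact: mem_enum.
rewrite natr_sum; apply: eq_big_seq => F /eE eF.
by rewrite /hi /lo eF.
Qed.

(** Some hyperplane orthogonal to [z] meets [P] and avoids all generators. That section is compact,
    so it has a vertex, which lies on an edge. *)
Lemma hull_has_edge z : P° !=set0 -> z != 0 -> edges P !=set0.
Proof.
move=> iP z0; have [x [y [Px Py xy]]] := interior_width iP z0.
have [t [/andP[xt ty] tN]] := itv_avoid [seq dotp z (p i) | i : 'I_m] xy.
have zp i : dotp z (p i) != t.
  by apply: contraNneq tN => <-; apply/mapP; exists i => //; exact: mem_enum.
have [s [_ _ zs Ps]] := convex_cross (@hull_convex _ _ _ p) Px Py xt ty.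
have cS : compact (section P z t).
  apply: compact_closedI; first exact: hull_compact.
  apply: (@preimage_closed _ _ (dotp z) [set x | x = t]); last exact: closed_eq.
  move=> w _; apply: (@continuous_dotp R d V (fun=> z) id) => w'.
    exact: cst_continuous.
  exact: cvg_id.
have [w /(section_vertex_edge zp)[F [eF _ _]]] := compact_has_vertex cS
  (ex_intro _ _ (conj Ps zs)).
by exists F.
Qed.

End Average.

(** * Zonotopes: widths and edges *)

Section Zonotopes.
Variables (R : realType) (d n : nat) (c : 'rV[R]_d) (a : 'I_n -> 'rV[R]_d).
Local Notation V := 'rV[R]_d.
Implicit Types (F : set V) (x y z : V).
Local Notation Z :=
  [set c + x | x in minkowski_sum (fun i => segment 0 (a i))].

Lemma zonotopeP y : Z y <-> exists s : 'I_n -> R,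
  (forall i, 0 <= s i <= 1) /\ y = c + \sum_i s i *: a i.
Proof.
split=> [[_ [x xs <-] <-]|[s [s01 ->]]].
  have /choice[s sP] : forall i, exists s : R, 0 <= s <= 1 /\ x i = s *: a i.
    move=> i; have /segmentP[s [s0 s1 E]] := xs i.
    by exists s; rewrite E add0r subr0 s0 s1.
  exists s; split => [i|]; first by case: (sP i).
  by congr (_ + _); apply: eq_bigr => i _; case: (sP i).
exists (\sum_i s i *: a i) => //; exists (fun i => s i *: a i) => // i.
by apply/segmentP; exists (s i); rewrite add0r subr0; case/andP: (s01 i).
Qed.

Lemma zonotope_move (s : 'I_n -> R) i (r : R) :
  (forall i, 0 <= s i <= 1) -> 0 <= r <= 1 ->
  Z (c + \sum_j s j *: a j + (r - s i) *: a i).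
Proof.
move=> s01 r01; apply/zonotopeP; exists (fun j => if j == i then r else s j).
split=> [j|]; first by case: ifP.
rewrite -addrA; congr (_ + _); rewrite (bigD1 i) //= [RHS](bigD1 i) //=.
rewrite eqxx addrAC -scalerDl [_ + (_ - _)]addrC subrK; congr (_ + _).
by apply: eq_bigr => j /negPf ->.
Qed.

Lemma zonotope_compact : compact Z.
Proof.
rewrite (_ : Z = [set c + \sum_i w 0 i *: a i | w in
    [set w : 'rV[R]_n | forall i, `[0, 1]%classic (w 0 i)] `&` setT]).
  exact/compact_cube_image/closedT.
apply/seteqP; split=> [y /zonotopeP[s [s01 ->]]|_ [w [w01 _] <-]].
  exists (\row_i s i); last by congr (_ + _); apply: eq_bigr => i _; rewrite mxE.
  by split => // i; rewrite mxE /= in_itv /= s01.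
by apply/zonotopeP; exists (w 0); split.
Qed.

Lemma zonotope_segment_closed : segment_closed Z.
Proof.
move=> _ _ t /zonotopeP[s [s01 ->]] /zonotopeP[s' [s'01 ->]] t0 t1.
apply/zonotopeP; exists (fun i => s i + t * (s' i - s i)); split=> [i|].
  have /andP[h1 h2] := s01 i; have /andP[h3 h4] := s'01 i.
  by apply/andP; split; nra.
rewrite -addrA; congr (_ + _).
rewrite opprD addrACA subrr add0r -sumrB scaler_sumr -big_split.
by apply: eq_bigr => i _ /=; rewrite scalerDl -scalerA scalerBl.
Qed.

(** The maximum is reached with coefficient 1 on the generators of positive height and 0 on the
    others. *)
Lemma zonotope_tmax z :
  tmax Z z = dotp z c + \sum_i (0 < dotp z (a i))%R%:R * dotp z (a i).
Proof.
pose x := c + \sum_i ((0 < dotp z (a i))%R%:R : R) *: a i.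
have Zx : Z x.
  apply/zonotopeP; exists (fun i => (0 < dotp z (a i))%R%:R); split => // i.
  by rewrite ler0n lern1 leq_b1.
have h y : Z y -> dotp z y <= dotp z x.
  move=> /zonotopeP[s [s01 ->]]; rewrite !dotpDr !dotp_sumr lerD2l.
  apply: ler_sum => i _; rewrite !dotpZr; have /andP[h1 h2] := s01 i.
  by case: ltP => h3; rewrite /= ?mul1r ?mul0r; nra.
rewrite (tmaxE Zx h) dotpDr dotp_sumr; congr (_ + _).
by apply: eq_bigr => i _; rewrite dotpZr.
Qed.

Lemma zonotope_width z : tmax Z z - tmin Z z = \sum_i `|dotp z (a i)|.
Proof.
rewrite tminN opprK !zonotope_tmax dotpNl addrACA subrr add0r -big_split.
apply: eq_bigr => i _ /=; rewrite dotpNl oppr_gt0.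
by case: ltgtP => [h|h|<-]; rewrite /= ?normr0 ?(gtr0_norm h) ?(ltr0_norm h); ring.
Qed.

Hypothesis noncol : forall i j, i != j -> ~ collinear (a i) (a j).

(** Let [u] cut out [F]. On [F] the coefficient of a generator not orthogonal to [u] is forced to 0
    or 1, while that of an orthogonal one moves freely. As [F] lies on a line, non-collinearity
    leaves a single orthogonal generator, and [F] is a translate of its segment. *)
Lemma zonotope_edge F : edges Z F ->
  exists i q, a i != 0 /\ F = segment q (q + a i).
Proof.
move=> [[u [b [ub FE]]] /has_dim1_line[v [x0 [y0 [v0 Fx0 Fy0 xy0 Fv]]]]].
have Zx0 : Z x0 by move: Fx0; rewrite FE => -[].
have ux0 : dotp u x0 = b by move: Fx0; rewrite FE => -[].
have [s [s01 x0E]] := (zonotopeP x0).1 Zx0.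
pose x t i := x0 + (t - s i) *: a i.
have Zx i t : 0 <= t <= 1 -> Z (x t i).
  by rewrite /x x0E; exact: zonotope_move.
have ux i t : dotp u (x t i) = b + (t - s i) * dotp u (a i).
  by rewrite dotpDr dotpZr ux0.
have Fx i t : dotp u (a i) = 0 -> 0 <= t <= 1 -> F (x t i).
  by move=> ui t01; rewrite FE; split; [exact: Zx|rewrite /= ux ui mulr0 addr0].
have aline i : dotp u (a i) = 0 -> a i \in <[v]>%VS.
  move=> ui; have -> : a i = x 1 i - x 0 i.
    rewrite /x opprD addrACA subrr add0r -scalerBl opprB addrA subrK.
    by rewrite subr0 scale1r.
  by apply: Fv; apply: Fx; rewrite // ?lexx ler01.
(* Resetting one coefficient to 0 or to 1 stays in the zonotope and cannot raise [dotp u] above its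
   maximum [b]. *)
have sE y t : (forall i, 0 <= t i <= 1) -> y = c + \sum_i t i *: a i -> F y ->
    forall i, dotp u (a i) != 0 -> t i = (0 < dotp u (a i))%R%:R.
  move=> t01 yE Fy i ui.
  have Zy : Z y by move: Fy; rewrite FE => -[].
  have uy : dotp u y = b by move: Fy; rewrite FE => -[].
  have key r : 0 <= r <= 1 -> (r - t i) * dotp u (a i) <= 0.
    move=> r01; rewrite -(lerD2l b) addr0 -{1}uy -dotpZr -dotpDr; apply: ub.
    by rewrite yE; exact: zonotope_move.
  have /andP[t0 t1] := t01 i.
  have k0 : (0 - t i) * dotp u (a i) <= 0 by apply: key; rewrite lexx ler01.
  have k1 : (1 - t i) * dotp u (a i) <= 0 by apply: key; rewrite lexx ler01.
  case: ltgtP ui => // h _; apply/eqP; rewrite eq_le /=.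
    by apply/andP; split; nra.
  by apply/andP; split; nra.
(* Otherwise every coefficient of a nonzero generator is forced, and [F] is a single point. *)
have [i [ui ai]] : exists i, dotp u (a i) = 0 /\ a i != 0.
  apply: contrapT => no; case/negP: xy0.
  have [s' [s'01 y0E]] : exists s' : 'I_n -> R,
      (forall i, 0 <= s' i <= 1) /\ y0 = c + \sum_i s' i *: a i.
    by apply/zonotopeP; move: Fy0; rewrite FE => -[].
  rewrite x0E y0E; apply/eqP; congr (_ + _); apply: eq_bigr => i _.
  have [ui|ui] := eqVneq (dotp u (a i)) 0.
    have [->|ai] := eqVneq (a i) 0; first by rewrite !scaler0.
    by case: no; exists i.
  by rewrite (sE _ _ s01 x0E Fx0) // (sE _ _ s'01 y0E Fy0).
have uj j : j != i -> dotp u (a j) != 0.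
  move=> ji; apply/eqP => uj0; apply: (noncol ji).
  by exists v; split; exact: aline.
exists i, (x 0 i); split => //.
have qa : x 0 i + a i - x 0 i = a i by rewrite addrAC subrr add0r.
have x1 r : x 0 i + r *: a i = x r i.
  by rewrite /x -addrA -scalerDl sub0r [- _ + _]addrC.
apply/seteqP; split=> [y Fy|_ /segmentP[r [r0 r1 ->]]]; last first.
  by rewrite qa x1; apply: Fx => //; rewrite r0.
have [s' [s'01 yE]] : exists s' : 'I_n -> R,
    (forall i, 0 <= s' i <= 1) /\ y = c + \sum_i s' i *: a i.
  by apply/zonotopeP; move: Fy; rewrite FE => -[].
apply/segmentP; exists (s' i); have /andP[h0 h1] := s'01 i; split => //.
rewrite qa x1 /x x0E yE -addrA; congr (_ + _).
rewrite (bigD1 i) //= [X in _ = X + _](bigD1 i) //= addrAC -scalerDl.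
rewrite [_ + (_ - _)]addrC subrK.
congr (_ + _); apply: eq_bigr => j ji.
by rewrite (sE _ _ s01 x0E Fx0) ?uj // (sE _ _ s'01 yE Fy) ?uj.
Qed.

End Zonotopes.

(** * Symmetric convex bodies are determined by centre and widths *)

Section SymmetricBodies.
Variables (R : realType) (d : nat).
Local Notation V := 'rV[R]_d.
Implicit Types (K L : set V) (c x y z u v w : V).

Lemma compact_tmax K z : compact K -> K !=set0 ->
  exists x, K x /\ forall y, K y -> dotp z y <= dotp z x.
Proof.
move=> cK K0; have cf : {within K, continuous (dotp z)}.
  apply: continuous_subspaceT; apply: (@continuous_dotp R d V (fun=> z) id) => w.
    exact: cst_continuous.
  exact: cvg_id.
have [x] := compact_EVT_max K0 cK cf; rewrite inE => Kx maxx.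
by exists x; split => // y Ky; apply: maxx; rewrite inE.
Qed.

(** The symmetry sends a highest point to a lowest one, so the height of the centre is the mean of
    the extreme heights. *)
Lemma symmetric_tmax K c z : compact K -> K !=set0 ->
  (forall x, K x -> K (c *+ 2 - x)) ->
  tmax K z = dotp z c + (tmax K z - tmin K z) / 2.
Proof.
move=> cK K0 sK; have [x [Kx maxx]] := compact_tmax z cK K0.
rewrite (tmaxE Kx maxx) (tminE (sK _ Kx)) => [|y /sK/maxx].
  by rewrite dotpBr mulr2n dotpDr; field.
by rewrite !dotpBr mulr2n !dotpDr; lra.
Qed.

(** With a common centre, equal widths give equal [tmax]. A functional separating a point of [K]
    from [L] would have a larger maximum on [K] than on [L]. *)
Lemma eq_width_subset K L c : compact K -> compact L -> segment_closed L ->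
  K !=set0 -> L !=set0 ->
  (forall x, K x -> K (c *+ 2 - x)) -> (forall x, L x -> L (c *+ 2 - x)) ->
  (forall z, z != 0 -> tmax K z - tmin K z = tmax L z - tmin L z) -> K `<=` L.
Proof.
move=> cK cL vL K0 L0 sK sL eKL x Kx; apply: contrapT => Lx.
have [u ux] := separation cL vL Lx.
have [y [Ly maxy]] := compact_tmax u cL L0.
have [x' [Kx' maxx']] := compact_tmax u cK K0.
(* Widths are compared in nonzero directions only; strict separation from a nonempty set excludes
   [u = 0]. *)
have u0 : u != 0.
  by apply: contraTneq (ux _ Ly) => ->; rewrite ![dotp 0 _]dotpC !dotp0r ltxx.
have e : tmax K u = tmax L u.
  by rewrite (symmetric_tmax u cK K0 sK) (symmetric_tmax u cL L0 sL) eKL.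
have := ux _ Ly; rewrite -(tmaxE Ly maxy) -e (tmaxE Kx' maxx') ltNge.
by rewrite maxx'.
Qed.

Lemma line_eq v w : v != 0 -> v \in <[w]>%VS -> <[v]>%VS = <[w]>%VS.
Proof.
move=> v0; rewrite memvE => vw; apply/eqP; rewrite eqEdim vw !dim_vline v0.
exact: leq_b1.
Qed.

Lemma parallel_segment q v w :
  parallel (segment q (q + w)) v <-> w \in <[v]>%VS.
Proof.
have qw : q + w - q = w by rewrite addrAC subrr add0r.
split=> [h|wv x y /segmentP[s [_ _ ->]] /segmentP[t [_ _ ->]]].
  by rewrite -qw; apply: h; [exact: segment_l|exact: segment_r].
by rewrite qw opprD addrACA subrr add0r -scalerBl memvZ.
Qed.

Lemma collinear_line v w : v != 0 -> w != 0 -> collinear v w ->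
  <[v]>%VS = <[w]>%VS.
Proof. by move=> v0 w0 [l [vl wl]]; rewrite (line_eq v0 vl) (line_eq w0 wl). Qed.

End SymmetricBodies.

(** * Edge widths of a zonotope, grouped by generator *)

Section ZonotopeEdges.
Variables (R : realType) (d n : nat) (P : set 'rV[R]_d) (a : 'I_n -> 'rV[R]_d).
Hypotheses (zP : zonotope P a) (fE : finite_set (edges P)).

Lemma edge_parallel F : edges P F -> exists i q,
  F = segment q (q + a i) /\ forall j, parallel F (a j) <-> j = i.
Proof.
case: zP => _ nc [c PE] eF; rewrite PE in eF.
have [i [q [ai FE]]] := zonotope_edge nc eF.
exists i, q; split => // j; rewrite FE parallel_segment; split=> [aij|->].
  apply: contrapT => /eqP/nc; apply; exists (a j); split => //; exact: memv_line.
exact: memv_line.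
Qed.

Lemma parallel_edges_width i z :
  \sum_(F <- fset_set (edges P))
    (F \in [set F | parallel F (a i)])%:R * (tmax F z - tmin F z) =
  (ncard (edges_parallel P (a i)))%:R * `|dotp z (a i)|.
Proof.
rewrite ncard_setI // natr_sum mulr_suml; apply: eq_big_seq => F.
rewrite in_fset_set // inE => /edge_parallel[j [q [FE Fp]]].
case: (boolP (F \in _)) => [|_]; last by rewrite !mul0r.
by rewrite inE => /Fp ->; rewrite FE segment_width [q + _]addrC addrK.
Qed.

(** Each edge is parallel to exactly one generator, of which it is a translate. *)
Lemma edges_width z :
  \sum_(F <- fset_set (edges P)) (tmax F z - tmin F z) =
  \sum_i (ncard (edges_parallel P (a i)))%:R * `|dotp z (a i)|.
Proof.
under [RHS]eq_bigr do rewrite -parallel_edges_width.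
rewrite exchange_big; apply: eq_big_seq => F.
rewrite in_fset_set // inE => /edge_parallel[i [q [_ Fp]]].
rewrite (bigD1 i) //= mem_set ?mul1r ?big1 ?addr0 //; first last.
  by apply/Fp.
by move=> j /eqP ji; rewrite memNset ?mul0r // => /Fp.
Qed.

End ZonotopeEdges.

(** * From constant average to a zonotope *)

Section Characterization.
Variables (R : realType) (d m : nat) (p : 'I_m -> 'rV[R]_d) (lambda : R).
Local Notation V := 'rV[R]_d.
Local Notation P := (conv_hull p).
Hypothesis iP : P° !=set0.
Implicit Types (F : set V) (z : V).

Lemma interior_nonempty : P !=set0.
Proof. by case: iP => x /interior_subset; exists x. Qed.

Lemma width_gt0 z : z != 0 -> 0 < tmax P z - tmin P z.
Proof.
move=> z0; have [x [y [Px Py xy]]] := interior_width iP z0.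
have := (hull_tmax z interior_nonempty).2 _ Py.
have := (hull_tmin z interior_nonempty).2 _ Px; lra.
Qed.

Lemma avg_vertices_constE : (forall z, z != 0 -> avg_vertices P z = lambda) <->
  (forall z, z != 0 -> \sum_(F <- fset_set (edges P)) (tmax F z - tmin F z) =
     lambda * (tmax P z - tmin P z)).
Proof.
split=> h z z0; have W0 := width_gt0 z0.
  rewrite -(h _ z0) avg_vertices_edges; last exact: interior_nonempty.
  by rewrite mulrAC mulVf ?mul1r // gt_eqF.
rewrite avg_vertices_edges; last exact: interior_nonempty.
by rewrite h // mulrCA mulVf ?mulr1 // gt_eqF.
Qed.

(** With fewer than [d] generators some nonzero [z] is orthogonal to all of them, and the width of
    [P] along [z] would be zero. *)
Lemma zonotope_generators_ge n (a : 'I_n -> V) c :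
  P = [set c + x | x in minkowski_sum (fun i => segment 0 (a i))] -> (d <= n)%N.
Proof.
move=> PE; rewrite leqNgt; apply/negP => nd.
pose A : 'M[R]_(d, n) := \matrix_(i, j) a j 0 i.
have : kermx A != 0.
  rewrite kermx_eq0 /row_free; apply: contraTneq nd => <-.
  by rewrite -leqNgt; exact: rank_leq_col.
move=> /rowV0Pn[z /sub_kermxP zA z0]; have := width_gt0 z0.
rewrite PE zonotope_width big1 ?ltxx // => j _.
suff -> : dotp z (a j) = (z *m A) 0 j by rewrite zA mxE normr0.
by rewrite mxE; apply: eq_bigr => i _; rewrite mxE.
Qed.

Section Generators.
Hypothesis l0 : 0 < lambda.
Hypothesis sP : centrally_symmetric P.
Hypothesis edgesE : forall z, z != 0 ->
  \sum_(F <- fset_set (edges P)) (tmax F z - tmin F z) =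
  lambda * (tmax P z - tmin P z).

Lemma zonotope_of_edges : exists n (a : 'I_n -> V), zonotope P a /\
  forall i, (ncard (edges_parallel P (a i)))%:R = lambda.
Proof.
have [c0 sc0] := sP.
have P0 := interior_nonempty.
have fE : finite_set (edges P) := edges_finite p.
(* The orientation of the edge vector [e F] is arbitrary: only absolute values of its scalar
   products occur below. *)
have /choice[e eP] : forall F, exists v, edges P F ->
    v != 0 /\ exists q, F = segment q (q + v).
  move=> F; case: (pselect (edges P F)) => [eF|]; last by exists 0.
  have [i [j [ij _ FE]]] := edge_segment 0 eF.
  exists (p j - p i) => _; split; first by rewrite subr_eq0 eq_sym.
  by exists (p i); rewrite addrC subrK.
pose es := fset_set (edges P).
have esE F : F \in es -> edges P F by rewrite in_fset_set // inE.
have wE F z : F \in es -> tmax F z - tmin F z = `|dotp z (e F)|.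
  move=> /esE/eP[_ [q FE]].
  by rewrite [in LHS]FE segment_width [q + _]addrC addrK.
pose dirs := undup [seq <[e F]>%VS | F <- es].
have dirsE F : F \in es -> <[e F]>%VS \in dirs.
  by move=> FE; rewrite mem_undup; apply/mapP; exists F.
pose D (i : 'I_(size dirs)) := tnth (in_tuple dirs) i.
have DI : injective D by apply/tuple_uniqP; exact: undup_uniq.
have Dex F : F \in es -> exists i, D i = <[e F]>%VS.
  by move=> /dirsE /(tnthP (in_tuple dirs))[i ->]; exists i.
have De i : exists F, F \in es /\ D i = <[e F]>%VS.
  have : D i \in dirs by exact: mem_tnth.
  by rewrite mem_undup => /mapP[F FE ->]; exists F.
pose b i := vpick (D i).
have b0 i : b i != 0.
  have [F [/esE/eP[eF0 _] DE]] := De i.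
  by rewrite vpick0 DE -dimv_eq0 dim_vline eF0.
have bD i : <[b i]>%VS = D i.
  have [F [_ DE]] := De i; rewrite DE; apply: line_eq => //.
  by rewrite -DE memv_pick.
have bb i := dotp_gt0 (b0 i).
(* If [e F = r *: b i], the summand is the absolute value of [r]. So [k i *: b i] is the sum of the
   edge vectors along [D i], all oriented like [b i]. *)
pose k i := \sum_(F <- es | <[e F]>%VS == D i)
  (`|dotp (b i) (e F)| / dotp (b i) (b i)).
have k0 i : 0 < k i.
  have [F [Fes DE]] := De i; rewrite /k (big_rem F) //= DE eqxx.
  apply: ltr_pwDl; last first.
    by apply: sumr_ge0 => G _; rewrite divr_ge0 // ltW.
  have /vlineP[r rE] : e F \in <[b i]>%VS by rewrite bD DE memv_line.
  rewrite divr_gt0 // normr_gt0 rE dotpZr mulf_neq0 ?(gt_eqF (bb i)) //.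
  have [eF0 _] := eP _ (esE _ Fes).
  by apply: contraNneq eF0 => r0; rewrite rE r0 scale0r.
pose a i := (k i / lambda) *: b i.
have a0 i : a i != 0 by rewrite scaler_eq0 negb_or b0 gt_eqF // divr_gt0.
have aD i : <[a i]>%VS = D i.
  by rewrite -bD; apply: line_eq => //; rewrite memvZ ?memv_line.
have dirE i z : \sum_(F <- es | <[e F]>%VS == D i) `|dotp z (e F)| =
    lambda * `|dotp z (a i)|.
  rewrite dotpZr normrM (gtr0_norm (divr_gt0 (k0 i) l0)) mulrA.
  rewrite [_ * (_ / _)]mulrC divfK ?gt_eqF // mulr_suml.
  apply: eq_bigr => F /eqP FD.
  have /vlineP[r ->] : e F \in <[b i]>%VS by rewrite bD -FD memv_line.
  rewrite !dotpZr !normrM (gtr0_norm (bb i)) mulfK ?gt_eqF //.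
have totE z : \sum_(F <- es) `|dotp z (e F)| = lambda * \sum_i `|dotp z (a i)|.
  rewrite mulr_sumr; under [RHS]eq_bigr do rewrite -dirE big_mkcond.
  rewrite exchange_big; apply: eq_big_seq => F /Dex[i Di] /=.
  rewrite (bigD1 i) //= Di eqxx big1 ?addr0 // => j ji.
  by rewrite -Di (inj_eq DI) eq_sym (negPf ji).
have noncol i j : i != j -> ~ collinear (a i) (a j).
  move=> /eqP ij /collinear_line-/(_ (a0 i) (a0 j)); rewrite !aD => /DI; exact: ij.
(* The centre of the zonotope, [c] plus half the sum of the generators, is thus the centre [c0] of
   [P]. *)
pose c := c0 - 2^-1 *: \sum_i a i.
pose Z := [set c + x | x in minkowski_sum (fun i => segment 0 (a i))].
have Z0 : Z !=set0.
  exists c; apply/zonotopeP; exists (fun=> 0); split => [i|].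
    by rewrite lexx ler01.
  by rewrite big1 ?addr0 // => i _; rewrite scale0r.
have sZ x : Z x -> Z (c0 *+ 2 - x).
  move=> /zonotopeP[s [s01 ->]]; apply/zonotopeP; exists (fun i => 1 - s i).
  split=> [i|]; first by have := s01 i; lra.
  have -> : \sum_i (1 - s i) *: a i = \sum_i a i - \sum_i s i *: a i.
    by rewrite -sumrB; apply: eq_bigr => i _; rewrite scalerBl scale1r.
  by apply/rowP => i; rewrite /c !mxE; field.
have eW z : z != 0 -> tmax P z - tmin P z = tmax Z z - tmin Z z.
  move=> z0; apply: (mulfI (lt0r_neq0 l0)); rewrite -edgesE // zonotope_width.
  by rewrite -totE; apply: eq_big_seq => F; exact: wE.
have PZ : P = Z.
  apply/seteqP; split.
    apply: (eq_width_subset (c := c0)) => //; first exact: hull_compact.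
      exact: zonotope_compact.
    exact: zonotope_segment_closed.
  apply: (eq_width_subset (c := c0)) => //; first exact: zonotope_compact.
  - exact: hull_compact.
  - exact: hull_convex.
  - by move=> z z0; rewrite eW.
have zP : zonotope P a.
  split; [exact: zonotope_generators_ge PZ|exact: noncol|by exists c].
exists (size dirs), a; split => // i.
(* Multiplied by [dotp (a i) (a i)], both sides become the total width, in direction [a i], of the
   edges parallel to [a i]: the left one because these are translates of the generator, the right
   one by the choice of its length. *)
apply: (mulIf (lt0r_neq0 (dotp_gt0 (a0 i)))).
rewrite -[dotp (a i) (a i)]ger0_norm ?dotp_ge0 // -(parallel_edges_width zP) //.
rewrite -dirE [RHS]big_mkcond; apply: eq_big_seq => F Fes.
have [eF0 [q FE]] := eP _ (esE _ Fes); rewrite wE //.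
suff -> : (F \in [set F | parallel F (a i)]) = (<[e F]>%VS == D i).
  by case: ifP; rewrite ?mul1r ?mul0r.
have par : parallel F (a i) <-> e F \in <[a i]>%VS.
  by rewrite [in X in X <-> _]FE; exact: parallel_segment.
rewrite -aD; apply/idP/eqP => [|ea].
  by rewrite inE => /par; exact: line_eq.
by rewrite inE; apply/par; rewrite -ea memv_line.
Qed.

End Generators.
End Characterization.

(** * Dimension zero, and the equivalence *)

Lemma rV0_zonotope (R : realType) (P : set 'rV[R]_0) : P !=set0 ->
  zonotope P (fun _ : 'I_0 => 0).
Proof.
move=> [x Px]; split => // [[]//|]; exists 0.
apply/seteqP; split=> y _; last by rewrite [y]thinmx0 -[0](thinmx0 x).
apply/zonotopeP; exists (fun=> 0); split; first by case.
by rewrite !thinmx0.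
Qed.

Theorem theorem2 (R : realType) (d : nat) (P : set 'rV[R]_d) (lambda : R) :
  convex_polytope P -> P° !=set0 -> centrally_symmetric P ->
  (forall z : 'rV[R]_d, z != 0 -> avg_vertices P z = lambda) <->
  (exists (n : nat) (a : 'I_n -> 'rV[R]_d),
     zonotope P a /\
     forall i : 'I_n, (ncard (edges_parallel P (a i)))%:R = lambda).
Proof.
case=> m [p ->] iP sP; rewrite avg_vertices_constE //; split; last first.
  move=> [n [a [zP Na]]] z _; rewrite (edges_width zP); last exact: edges_finite.
  have -> : tmax (conv_hull p) z - tmin (conv_hull p) z = \sum_i `|dotp z (a i)|.
    by case: zP => _ _ [c ->]; exact: zonotope_width.
  by rewrite mulr_sumr; apply: eq_bigr => i _; rewrite Na.
(* For [d = 0] there is no nonzero [z] and [P] is a point; with the empty family of generators the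
   condition on edge counts is vacuous. *)
case: d P p iP sP => [|d] _ p iP sP edgesE.
  exists 0%N, (fun=> 0); split; last by case.
  exact/rV0_zonotope/interior_nonempty.
have one0 : const_mx 1 != 0 :> 'rV[R]_d.+1.
  by apply/eqP => /rowP/(_ 0)/eqP; rewrite !mxE oner_eq0.
have [F0 eF0] := hull_has_edge iP one0.
apply: zonotope_of_edges => //.
(* It remains to show [0 < lambda]. In the direction of the edge [F0] itself, [F0] has positive
   width and the other edges have nonnegative width, so [lambda] times the width of the polytope is
   positive. *)
have [i [j [ij _ FE]]] := edge_segment 0 eF0.
have z0 : p j - p i != 0 by rewrite subr_eq0 eq_sym.
rewrite -(pmulr_lgt0 _ (width_gt0 iP z0)) -edgesE // (big_rem F0) /=; last first.
  by rewrite in_fset_set ?inE //; exact: edges_finite.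
apply: ltr_pwDl.
  by rewrite FE segment_width normr_gt0 gt_eqF // dotp_gt0.
rewrite big_seq; apply: sumr_ge0 => F /mem_rem.
rewrite in_fset_set ?inE; last exact: edges_finite.
by move=> /edge_tmin_tmax-/(_ (p j - p i))[_ + _]; rewrite subr_ge0.
Qed.
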